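(* Let $R$ be an integral domain of characteristic zero. The set $\rho_t\mathfrak{A}(H_R[[x]])$ with the sum $\boxplus$ and the product $\odot$ is a commutative ring with neutral element for the sum $\rho_t\mathfrak{A}(0)=x$ and neutral element for the product $\rho_t\mathfrak{A}(1)=x+t$.
   Context: For a commutative ring $T$, $H_T[[x]]$ is the Hurwitz ring of formal series $f(x)=\sum_{n\ge 0}a_n\frac{x^n}{n!}$ with $a_n\in T$ (formally, sequences $(a_n)$), with termwise addition and product $\left(\sum a_n\frac{x^n}{n!}\right)\left(\sum b_n\frac{x^n}{n!}\right)=\sum_n\left(\sum_{k=0}^n\binom nk a_kb_{n-k}\right)\frac{x^n}{n!}$, and derivation $\delta\left(\sum a_n\frac{x^n}{n!}\right)=\sum a_{n+1}\frac{x^n}{n!}$. Bell polynomials: for $n\ge1$, $Y_n(b_1,\dots,b_n;a_1,\dots,a_n)=\sum_{k=1}^nB_{n,k}a_k$ with $B_{n,k}=\sum\frac{n!}{j_1!\cdots j_n!}\left(\frac{b_1}{1!}\right)^{j_1}\cdots\left(\frac{b_n}{n!}\right)^{j_n}$, the sum over non-negative integers with $j_1+2j_2+\cdots+nj_n=n$ and $j_1+\cdots+j_n=k$ (these polynomials have integer coefficients). Autonomous polynomials: for $f\in H_R[[x]]$, $A_0(f)=x$, $A_1(f)=f$, and $A_{n+1}(f)=Y_n(A_1(f),\dots,A_n(f);\delta f,\dots,\delta^nf)$ for $n\ge1$. The autonomous operator sends $f$ to the sequence $\mathfrak{A}(f)=(A_0(f),A_1(f),A_2(f),\dots)$ of elements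 of $H_R[[x]]$, and $\mathfrak{A}(H_R[[x]])=\{\mathfrak{A}(f):f\in H_R[[x]]\}$. Since $A_1(f)=f$, the map $\mathfrak{A}$ is injective. Operations on $\mathfrak{A}(H_R[[x]])$: $\mathfrak{A}(f)\boxplus\mathfrak{A}(g)=(B_n(f,g))_{n\ge0}$ with $B_0(f,g)=x$, $B_1(f,g)=A_1(f)+A_1(g)$, and $B_n(f,g)=A_n(f)+A_n(g)+H_n(f,g)$ for $n\ge2$, where $H_1(f,g)=0$ and $H_{n+1}(f,g)=f\,\delta A_n(g)+g\,\delta A_n(f)+(f+g)\,\delta H_n(f,g)$ for $n\ge1$; and $\mathfrak{A}(f)\odot\mathfrak{A}(g)=\mathfrak{A}(fg)$. Let $S=H_R[[x]]$. The map $\rho_t:\mathfrak{A}(H_R[[x]])\to H_S[[t]]$ is $\rho_t\mathfrak{A}(f)=x+\sum_{n\ge1}A_n(f)\frac{t^n}{n!}$, and $\rho_t\mathfrak{A}(H_R[[x]])$ is its image. Operations on the image: $\rho_t\mathfrak{A}(f)\boxplus\rho_t\mathfrak{A}(g)=\rho_t[\mathfrak{A}(f)\boxplus\mathfrak{A}(g)]$ and $\rho_t\mathfrak{A}(f)\odot\rho_t\mathfrak{A}(g)=\rho_t[\mathfrak{A}(f)\odot\mathfrak{A}(g)]$. *)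

(* Defs.v *)
From HB Require Import structures.
From mathcomp Require Import all_boot all_algebra.
From mathcomp Require Import boolp classical_sets.

Set Implicit Arguments.
Unset Strict Implicit.
Unset Printing Implicit Defensive.

Import GRing.Theory.
Local Open Scope ring_scope.

(* The series \sum_n a_n x^n / n! is represented by its coefficient sequence
   (a_n); no division by n! takes place in T. *)
Record hurwitz (T : Type) := Hurwitz { hcoef :> nat -> T }.

HB.instance Definition _ (T : Type) := gen_eqMixin (hurwitz T).
HB.instance Definition _ (T : Type) := gen_choiceMixin (hurwitz T).

Lemma hurwitzP (T : Type) (f g : hurwitz T) : f =1 g -> f = g.
Proof. by case: f g => [f] [g] /= /funext ->. Qed.

Section HurwitzRing.
Variable T : comPzRingType.
Implicit Types f g h : hurwitz T.

Definition hzero : hurwitz T := Hurwitz (fun=> 0).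
Definition hopp f : hurwitz T := Hurwitz (fun n => - f n).
Definition hadd f g : hurwitz T := Hurwitz (fun n => f n + g n).
Definition hconst (c : T) : hurwitz T := Hurwitz (fun n => if n is 0%N then c else 0).
Definition hmul f g : hurwitz T :=
  Hurwitz (fun n => \sum_(k < n.+1) (f k * g (n - k)%N) *+ 'C(n, k)).

Lemma haddA : associative hadd.
Proof. by move=> f g h; apply: hurwitzP => n /=; rewrite addrA. Qed.
Lemma haddC : commutative hadd.
Proof. by move=> f g; apply: hurwitzP => n /=; rewrite addrC. Qed.
Lemma hadd0 : left_id hzero hadd.
Proof. by move=> f; apply: hurwitzP => n /=; rewrite add0r. Qed.
Lemma haddN : left_inverse hzero hopp hadd.
Proof. by move=> f; apply: hurwitzP => n /=; rewrite addNr. Qed.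

HB.instance Definition _ :=
  GRing.isZmodule.Build (hurwitz T) haddA haddC hadd0 haddN.

Lemma hmulC : commutative hmul.
Proof.
move=> f g; apply: hurwitzP => n /=; rewrite (reindex_inj rev_ord_inj) /=.
apply: eq_bigr => k _.
by rewrite subSS bin_sub ?leq_ord // subKn ?leq_ord // mulrC.
Qed.

Lemma trinomial (i j k : nat) :
  (j + k <= i)%N -> ('C(i, j) * 'C(i - j, k) = 'C(i, k) * 'C(i - k, j))%N.
Proof.
move=> le_i.
have lej : (j <= i)%N by apply: leq_trans le_i; apply: leq_addr.
have lek : (k <= i)%N by apply: leq_trans le_i; apply: leq_addl.
have lekj : (k <= i - j)%N by rewrite leq_subRL.
have lejk : (j <= i - k)%N by rewrite leq_subRL // addnC.
apply/eqP; rewrite -(eqn_pmul2r (fact_gt0 j)) -(eqn_pmul2r (fact_gt0 k)).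
rewrite -(eqn_pmul2r (fact_gt0 (i - j - k))).
have E1 := bin_fact lej; have E2 := bin_fact lekj.
have E3 := bin_fact lek; have E4 := bin_fact lejk.
apply/eqP; transitivity i`!%N.
  by rewrite -E1 -[in RHS]E2 -!mulnA; congr muln; rewrite mulnCA.
rewrite -E3 -[in LHS]E4 -!mulnA (subnAC i k j); congr muln.
by rewrite mulnCA; congr muln; rewrite mulnCA.
Qed.

Lemma hmulE f g n :
  hmul f g n = \sum_(k < n.+1) (f k * g (n - k)%N) *+ 'C(n, k).
Proof. by []. Qed.

Lemma hmulA : associative hmul.
Proof.
move=> f g h; rewrite [RHS]hmulC; apply: hurwitzP => i; rewrite !hmulE.
pose c j k := (f j * (g (i - j - k)%N * h k)) *+ ('C(i, j) * 'C(i - j, k)).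
transitivity (\sum_(j < i.+1) \sum_(k < i.+1 | (k <= i - j)%N) c j k).
  apply: eq_bigr => j _.
  rewrite hmulC hmulE big_distrr /= -sumrMnl.
  rewrite (big_ord_narrow_leq (leq_subr _ _)) /=.
  apply: eq_bigr => k _; rewrite /c mulrnAr -mulrnA mulnC.
  by rewrite [h k * _]mulrC.
rewrite (exchange_big_dep predT) //; apply: eq_bigr => k _.
transitivity (\sum_(j < i.+1 | (j <= i - k)%N) c j k).
  apply: eq_bigl => j.
  by rewrite !leq_subRL -1?ltnS ?ltn_ord // addnC.
rewrite hmulE big_distrr /= -sumrMnl.
rewrite (big_ord_narrow_leq (leq_subr _ _)) /=.
apply: eq_bigr => j _; rewrite /c trinomial; last first.
  by rewrite addnC -leq_subRL -ltnS ?ltn_ord.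
by rewrite mulrnAr -mulrnA mulnC subnAC mulrA mulrC.
Qed.

Lemma hmul1 : left_id (hconst 1) hmul.
Proof.
move=> f; apply: hurwitzP => n /=; rewrite big_ord_recl /= mul1r subn0 bin0.
by rewrite big1 ?addr0 // => i _; rewrite mul0r mul0rn.
Qed.

Lemma hmulDl : left_distributive hmul hadd.
Proof.
move=> f g h; apply: hurwitzP => n /=; rewrite -big_split /=.
by apply: eq_bigr => k _; rewrite mulrDl mulrnDl.
Qed.

HB.instance Definition _ :=
  GRing.Zmodule_isComPzRing.Build (hurwitz T) hmulA hmulC hmul1 hmulDl.

Definition hvar : hurwitz T := Hurwitz (fun n => (n == 1%N)%:R).

Definition hderiv f : hurwitz T := Hurwitz (fun n => f n.+1).

End HurwitzRing.

Arguments hvar {T}.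

(* A multi-index (j_1, ..., j_n) is a finite function j with j_(i+1) = j i;
   the bound j_i <= n loses nothing since (i+1) * j i <= n. *)
Definition bell_index (n k : nat) (j : {ffun 'I_n -> 'I_n.+1}) : bool :=
  (\sum_(i < n) i.+1 * j i == n)%N && (\sum_(i < n) j i == k)%N.

(* n! / (j_1! ... j_n! (1!)^(j_1) ... (n!)^(j_n)): the division is exact,
   see bell_coef_exact. *)
Definition bell_coef (n : nat) (j : {ffun 'I_n -> 'I_n.+1}) : nat :=
  (n`! %/ \prod_(i < n) ((j i)`! * (i.+1)`! ^ j i))%N.

Lemma dvdn_fact_block (m e : nat) : (e`! * (m.+1)`! ^ e %| (m.+1 * e)`!)%N.
Proof.
elim: e => [|e IHe]; first by rewrite muln0.
have le1 : (m.+1 <= m.+1 * e.+1)%N by rewrite mulnS leq_addr.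
rewrite -(bin_fact le1).
have -> : (m.+1 * e.+1 - m.+1 = m.+1 * e)%N by rewrite mulnS addKn.
have -> : ('C(m.+1 * e.+1, m.+1) = e.+1 * 'C((m.+1 * e.+1).-1, m))%N.
  apply/eqP; rewrite -(eqn_pmul2l (ltn0Sn m)).
  by rewrite -mul_bin_diag mulnA.
rewrite factS expnS.
have -> : (e.+1 * e`! * ((m.+1)`! * (m.+1)`! ^ e)
          = (e.+1 * (m.+1)`!) * (e`! * (m.+1)`! ^ e))%N by rewrite mulnACA.
have IH : (e.+1 * (m.+1)`! * (e`! * (m.+1)`! ^ e)
           %| e.+1 * (m.+1)`! * (m.+1 * e)`!)%N.
  exact: dvdn_mul.
apply: dvdn_trans IH _.
rewrite [X in (_ %| X)%N]mulnACA; apply: dvdn_mul => //; exact: dvdn_mull.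
Qed.

Lemma bell_coef_exact (n k : nat) (j : {ffun 'I_n -> 'I_n.+1}) :
  bell_index k j ->
  (bell_coef j * \prod_(i < n) ((j i)`! * (i.+1)`! ^ j i) = n`!)%N.
Proof.
move=> /andP[/eqP sum_j _]; apply: divnK; rewrite -[X in (_ %| X`!)%N]sum_j.
apply: (big_ind2 (fun x y => x %| y`!)%N) => // [x1 y1 x2 y2 dv1 dv2|i _].
  rewrite -(bin_fact (leq_addr y2 y1)) addKn dvdn_mull //; exact: dvdn_mul.
exact: dvdn_fact_block.
Qed.

Section Autonomous.
Variable T : comPzRingType.

(* In a sequence b : nat -> T standing for (b_1, b_2, ...), the entry b 0 is
   never read. *)
Definition bellB (n k : nat) (b : nat -> T) : T :=
  \sum_(j : {ffun 'I_n -> 'I_n.+1} | bell_index k j)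
    (\prod_(i < n) b i.+1 ^+ j i) *+ bell_coef j.

Definition bellY (n : nat) (b a : nat -> T) : T :=
  \sum_(1 <= k < n.+1) bellB n k b * a k.

End Autonomous.

Section AutonomousOperator.
Variable R : comPzRingType.
Implicit Types (f g : hurwitz R) (u v : nat -> hurwitz R).

(* The list [:: A_0(f); ...; A_n(f)]. *)
Fixpoint aut_prefix f (n : nat) : seq (hurwitz R) :=
  match n with
  | 0 => [:: hvar]
  | 1 => [:: hvar; f]
  | m.+1 => let s := aut_prefix f m in
            rcons s (bellY m (nth 0 s) (fun k => iter k (@hderiv R) f))
  end.

(* The autonomous operator: aut f n is A_n(f). *)
Definition aut f : nat -> hurwitz R := fun n => nth 0 (aut_prefix f n) n.

Lemma aut_prefixSS f n :
  aut_prefix f n.+2 = rcons (aut_prefix f n.+1)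
    (bellY n.+1 (nth 0 (aut_prefix f n.+1)) (fun k => iter k (@hderiv R) f)).
Proof. by []. Qed.

Lemma size_aut_prefix f n : size (aut_prefix f n) = n.+1.
Proof. by elim: n => [|[|n] IHn] //; rewrite aut_prefixSS size_rcons IHn. Qed.

Lemma nth_aut_prefix f n i : (i <= n)%N -> nth 0 (aut_prefix f n) i = aut f i.
Proof.
elim: n => [|n IHn]; first by rewrite leqn0 => /eqP->.
rewrite leq_eqVlt => /predU1P[-> //|]; rewrite ltnS => le_in.
rewrite -IHn //; case: n le_in {IHn} => [|n] le_in.
  by move: le_in; rewrite leqn0 => /eqP->.
by rewrite aut_prefixSS nth_rcons size_aut_prefix ltnS le_in.
Qed.

Lemma aut0E f : aut f 0 = hvar. Proof. by []. Qed.

Lemma aut1E f : aut f 1 = f. Proof. by []. Qed.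

Lemma autSE f n : (0 < n)%N ->
  aut f n.+1 = bellY n (aut f) (fun k => iter k (@hderiv R) f).
Proof.
case: n => // n _; rewrite {1}/aut aut_prefixSS nth_rcons size_aut_prefix ltnn eqxx.
apply: eq_bigr => k _; congr (_ * _); apply: eq_bigr => j _.
congr (_ *+ _); apply: eq_bigr => i _; congr (_ ^+ _).
exact: nth_aut_prefix.
Qed.

Lemma aut_inj : injective aut.
Proof. by move=> f g eq_fg; rewrite -[f]aut1E eq_fg. Qed.

(* On the range of aut the series f is recovered from u = aut f as u 1, which
   is how the operations below read their arguments. The value H_0 is a dummy. *)
Fixpoint boxH u v (n : nat) : hurwitz R :=
  match n with
  | 0 | 1 => 0
  | m.+1 => u 1%N * hderiv (v m) + v 1%N * hderiv (u m)
            + (u 1%N + v 1%N) * hderiv (boxH u v m)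
  end.

Definition box_add u v : nat -> hurwitz R := fun n =>
  match n with
  | 0 => hvar
  | 1 => u 1%N + v 1%N
  | _ => u n + v n + boxH u v n
  end.

Definition box_mul u v : nat -> hurwitz R := aut (u 1%N * v 1%N).

(* x + \sum_(n >= 1) u_n t^n / n! as a series in t over hurwitz R. *)
Definition rho u : hurwitz (hurwitz R) :=
  Hurwitz (fun n => if n is 0%N then hvar else u n).

Definition rho_aut_set : set (hurwitz (hurwitz R)) :=
  range (fun f => rho (aut f)).

End AutonomousOperator.

Arguments rho_aut_set R : clear implicits.

(* Main.v *)
Require Import Defs.
From mathcomp Require Import all_boot all_algebra.
From mathcomp Require Import boolp classical_sets.
From mathcomp Require Import zify.
From HB Require Import structures.

(** The series [rho (aut f)] is the solution [y] of the autonomous equation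
    [dy/dt = f(y)], [y(0) = x]. Along the flow, [d/dt] acts on functions of [x]
    as the derivation [lie f = f * delta], so the [n]-th Taylor coefficient of
    [y] is [(lie f)^n x]. The Bell polynomials of the definition are
    what the Faa di Bruno formula gives for the derivatives of [f(y)].

    Once [aut f n = iter n (lie f) hvar] is known ([aut_lie]), the recursion
    [A_(n+1)(f) = f * delta A_n(f)] holds ([autS]), and expanding
    [(f + g) * delta (A_n(f) + A_n(g) + H_n(f, g))] yields exactly the
    recursion that defines [H]: hence
    [box_add (aut f) (aut g) = aut (f + g)] ([box_add_aut]). The product
    satisfies the same compatibility by definition. So [f |-> rho (aut f)],
    which is injective because [f] is the coefficient of [t], transports the
    ring structure of the Hurwitz series to its image, and the neutral elements
    are the images of [0] and [1].

    The work is in [faa_di_bruno], which expresses [(lie f)^n h] through the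
    Bell polynomials of the iterates [(lie f)^i x]. Both sides obey the same
    recursion in [n]: for [(lie f)^(n+1) h = (lie f)^n (f * delta h)] it is the
    Leibniz rule ([leibniz]), and for the Bell polynomials it is
      [B_(n+1,k+1) = sum_i C(n,i) b_(i+1) B_(n-i,k)]  ([bellB_rec]).
    The latter is proved on multi-indices, by removing one unit from a nonzero
    entry [j_(i+1)]; everything is integral, so no division by factorials is
    performed in the ring. *)

Set Implicit Arguments.
Unset Strict Implicit.
Unset Printing Implicit Defensive.

Import GRing.Theory.
Local Open Scope ring_scope.

(** * Multi-indices *)

Section MultiIndex.
Variable N : nat.
Implicit Types (i : 'I_N) (j : {ffun 'I_N -> 'I_N.+1}).

Definition mweight j : nat := (\sum_(i < N) i.+1 * j i)%N.
Definition mdeg j : nat := (\sum_(i < N) j i)%N.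
Definition mden j : nat := (\prod_(i < N) ((j i)`! * (i.+1)`! ^ j i))%N.

(** The number of partitions of a set of [mweight j] elements with [j i] blocks
    of size [i.+1]. The weight is read off [j] and not from the number [N]
    of variables: the recursion lowers the former and keeps the latter. *)
Definition mcoef j : nat := ((mweight j)`! %/ mden j)%N.
Definition mmono (T : comPzRingType) (b : nat -> T) j : T :=
  \prod_(i < N) b i.+1 ^+ j i.

Lemma mden_gt0 j : (0 < mden j)%N.
Proof. by apply: prodn_gt0 => i; rewrite muln_gt0 expn_gt0 !fact_gt0. Qed.

(** A block of [j i] parts of size [i.+1] contributes a divisor of
    [(i.+1 * j i)!], and a product of factorials divides the factorial of the
    sum. *)
Lemma mcoefK j : (mcoef j * mden j = (mweight j)`!)%N.
Proof.
apply: divnK.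
apply: (big_ind2 (fun x y => x %| y`!)%N) => // [x1 y1 x2 y2 dv1 dv2|i _].
  rewrite -(bin_fact (leq_addr y2 y1)) addKn dvdn_mull //; exact: dvdn_mul.
exact: dvdn_fact_block.
Qed.

Lemma leq_mweight i j : (i.+1 * j i <= mweight j)%N.
Proof. by rewrite /mweight (bigD1 i) //= leq_addr. Qed.

Lemma mdeg_le_mweight j : (mdeg j <= mweight j)%N.
Proof. by apply: leq_sum => i _; rewrite leq_pmull. Qed.

Definition mdec i j : {ffun 'I_N -> 'I_N.+1} :=
  [ffun l => if l == i then inord (j i).-1 else j l].
Definition minc i j : {ffun 'I_N -> 'I_N.+1} :=
  [ffun l => if l == i then inord (j i).+1 else j l].

Lemma mdec_at i j : mdec i j i = (j i).-1 :> nat.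
Proof.
by rewrite ffunE eqxx inordK // ltnS (leq_trans (leq_pred _)) // leq_ord.
Qed.

Lemma mincK i j : (j i < N)%N -> mdec i (minc i j) = j.
Proof.
move=> lt_jN; apply/ffunP => l; rewrite !ffunE eqxx.
case: eqP => [->|//]; apply: val_inj.
by rewrite /= (inordK (m := (j i).+1)) //= inordK // ltnW.
Qed.

(** Only a positive entry survives a decrement followed by an increment; a zero
    entry comes back as [1]. The pair [mdec i], [minc i] thus reindexes the
    multi-indices with [0 < j i]. *)
Lemma mdecK i j : (minc i (mdec i j) == j) = (0 < j i)%N.
Proof.
have N_gt0 : (0 < N)%N by apply: leq_trans (ltn_ord i).
have lt_j : ((j i).-1 < N)%N.
  by case: (nat_of_ord (j i)) (leq_ord (j i)).
apply/eqP/idP => [/ffunP/(_ i)|j_gt0].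
  rewrite ffunE eqxx mdec_at => /(congr1 val) /=.
  by rewrite inordK ?ltnS // => <-.
apply/ffunP => l; rewrite ffunE mdec_at prednK // inord_val.
by case: eqP => [->|/eqP ne_li] //; rewrite ffunE (negbTE ne_li).
Qed.

(** The weight, the degree, the denominator and the monomial are all of the form
    [\big[op/idx]_l F l (j l)], so that [mdec] only affects one factor. *)
Lemma big_mdec (S : Type) (idx : S) (op : Monoid.com_law idx)
    (F : 'I_N -> nat -> S) (x : S) i j :
  F i (j i) = op x (F i (j i).-1) ->
  \big[op/idx]_l F l (j l) = op x (\big[op/idx]_l F l (mdec i j l)).
Proof.
move=> FE; rewrite (bigD1 i) //= FE [in RHS](bigD1 i) //= mdec_at.
rewrite Monoid.mulmA; congr (op _ _); apply: eq_bigr => l ne_li.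
by rewrite ffunE (negbTE ne_li).
Qed.

Section Decrement.
Variables (i : 'I_N) (j : {ffun 'I_N -> 'I_N.+1}).
Hypothesis j_gt0 : (0 < j i)%N.

Lemma mweight_dec : mweight j = (i.+1 + mweight (mdec i j))%N.
Proof.
apply: (big_mdec (F := fun l m => l.+1 * m)%N).
by rewrite /= -mulnS prednK.
Qed.

Lemma mdeg_dec : mdeg j = (mdeg (mdec i j)).+1.
Proof.
rewrite -add1n.
by apply: (big_mdec (F := fun l m => m)); rewrite /= add1n prednK.
Qed.

Lemma mden_dec : mden j = (j i * (i.+1)`! * mden (mdec i j))%N.
Proof.
apply: (big_mdec (F := fun l m => m`! * (l.+1)`! ^ m)%N).
by case: (nat_of_ord (j i)) j_gt0 => // m _; rewrite factS expnS mulnACA.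
Qed.

Lemma mmono_dec (T : comPzRingType) (b : nat -> T) :
  mmono b j = b i.+1 * mmono b (mdec i j).
Proof.
apply: (big_mdec (F := fun l m => b l.+1 ^+ m)).
by rewrite /= -exprS prednK.
Qed.

End Decrement.

(** Counting set partitions of [n.+1] points by the block of size [i.+1] that
    contains a distinguished point, there are [C(n, i)] choices for the rest of
    this block. After clearing denominators the identity reads
    [n! * sum_i (i+1) j_i = n! * (n+1)], the definition of the weight. *)
Lemma mcoef_rec n j : mweight j = n.+1 ->
  mcoef j = (\sum_(i < N | (0 < j i)%N) mcoef (mdec i j) * 'C(n, i))%N.
Proof.
move=> wj; apply/eqP; rewrite -(eqn_pmul2r (mden_gt0 j)) mcoefK wj.
rewrite big_distrl /=; apply/eqP.
transitivity (\sum_(i < N | (0 < j i)%N) n`! * (i.+1 * j i))%N.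
  rewrite -big_distrr /= factS mulnC -{1}wj; congr muln.
  rewrite /mweight (bigID (fun i => 0 < j i)%N) /= [X in (_ + X)%N]big1 ?addn0 //.
  by move=> i; rewrite -eqn0Ngt => /eqP->; rewrite muln0.
apply: eq_bigr => i j_gt0.
have [wd le_in] : mweight (mdec i j) = (n - i)%N /\ (i <= n)%N.
  have := mweight_dec j_gt0; rewrite wj addSn => -[->].
  by rewrite addKn leq_addr.
rewrite (mden_dec j_gt0) -(bin_fact le_in) -wd -mcoefK factS.
move: (mcoef _) (mden _) 'C(n, i) (i`!) (nat_of_ord (j i)) => c d B p q.
by lia.
Qed.

End MultiIndex.

(** * Partial Bell polynomials *)

Section Bell.
Variable T : comPzRingType.
Implicit Types b : nat -> T.

Lemma bellBE n k b :
  bellB n k b = \sum_(j : {ffun 'I_n -> 'I_n.+1} |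
                     (mweight j == n) && (mdeg j == k)) mmono b j *+ mcoef j.
Proof.
by apply: eq_bigr => j /andP[/eqP wj _]; rewrite /mcoef /mweight wj.
Qed.

(** Padding by zeros and its inverse, the restriction to the first variables. *)
Definition mext n p (j : {ffun 'I_n -> 'I_n.+1}) :
    {ffun 'I_(n + p) -> 'I_(n + p).+1} :=
  [ffun i => if split i is inl l then inord (j l) else ord0].
Definition mres n p (j : {ffun 'I_(n + p) -> 'I_(n + p).+1}) :
    {ffun 'I_n -> 'I_n.+1} :=
  [ffun i => inord (j (lshift p i))].

Lemma mext_lshift n p (j : {ffun 'I_n -> 'I_n.+1}) l :
  mext p j (lshift p l) = j l :> nat.
Proof.
rewrite ffunE (unsplitK (inl l)) inordK // ltnS.
by rewrite (leq_trans (leq_ord _)) ?leq_addr.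
Qed.

Lemma mext_rshift n p (j : {ffun 'I_n -> 'I_n.+1}) l :
  mext p j (rshift n l) = 0%N :> nat.
Proof. by rewrite ffunE (unsplitK (inr l)). Qed.

Lemma mextK n p : cancel (@mext n p) (@mres n p).
Proof.
by move=> j; apply/ffunP => i; rewrite ffunE mext_lshift inord_val.
Qed.

(** In weight [n] the entries beyond position [n] vanish and the others are at
    most [n], so neither the restriction nor its truncation by [inord] loses
    anything. *)
Lemma mresK n p (j : {ffun 'I_(n + p) -> 'I_(n + p).+1}) :
  mweight j = n -> mext p (mres j) = j.
Proof.
move=> wj; apply/ffunP => i; apply: val_inj => /=.
rewrite -[i]splitK; case: (split i) => l /=.
  rewrite mext_lshift ffunE inordK // ltnS; apply: leq_trans (eq_leq wj).
  by apply: leq_trans (leq_mweight (lshift p l) j); rewrite leq_pmull.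
rewrite mext_rshift; apply/esym/eqP; rewrite -leqn0 leqNgt; apply/negP => j_gt0.
have := leq_mweight (rshift n l) j; rewrite wj leqNgt /= => /negP[].
by rewrite (@leq_trans (n + l).+1) ?ltnS ?leq_addr // leq_pmulr.
Qed.

Lemma big_mext (S : Type) (idx : S) (op : Monoid.law idx)
    (F : nat -> nat -> S) n p (j : {ffun 'I_n -> 'I_n.+1}) :
  (forall i, F i 0%N = idx) ->
  \big[op/idx]_(i < n + p) F i (mext p j i) = \big[op/idx]_(i < n) F i (j i).
Proof.
move=> F0; rewrite big_split_ord /= [X in op _ X]big1 => [|l _].
  by rewrite Monoid.mulm1; apply: eq_bigr => l _; rewrite mext_lshift.
by rewrite mext_rshift F0.
Qed.

(** Lets Bell polynomials of different orders be written as sums over one index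
    type, which [bellB_rec] requires since it mixes all orders up to
    [n.+1]. *)
Lemma bellB_widen n N k b : (n <= N)%N ->
  bellB n k b = \sum_(j : {ffun 'I_N -> 'I_N.+1} |
                     (mweight j == n) && (mdeg j == k)) mmono b j *+ mcoef j.
Proof.
move=> /subnKC <-; move: (N - n)%N => {N} p.
rewrite bellBE (reindex_onto (@mext n p) (@mres n p)) => [|j /andP[/eqP]].
  have wE j : mweight (mext p j) = mweight j.
    by apply: (big_mext _ (F := fun i m => i.+1 * m)%N) => i; rewrite muln0.
  apply: eq_big => [j|j _].
    rewrite mextK eqxx andbT wE; congr (_ && (_ == _)); apply/esym.
    exact: (big_mext _ (F := fun i m => m)).
  have mE : mmono b (mext p j) = mmono b j.
    by apply: (big_mext _ (F := fun i m => b i.+1 ^+ m)).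
  have dE : mden (mext p j) = mden j.
    by apply: (big_mext _ (F := fun i m => m`! * (i.+1)`! ^ m)%N).
  by rewrite /mcoef mE dE wE.
by move=> wj _; apply: mresK.
Qed.

(** If [beta_k] is the series with coefficients [B_(n,k)], the [k]-th divided
    power of [sum_(i >= 1) b_i t^i / i!], this is the coefficient form of
    [beta_(k+1)' = b' * beta_k]. *)
Lemma bellB_rec n k b :
  bellB n.+1 k.+1 b =
  \sum_(i < n.+1) (b i.+1 * bellB (n - i) k b) *+ 'C(n, i).
Proof.
transitivity (\sum_(j : {ffun 'I_n.+1 -> 'I_n.+2} |
     (mweight j == n.+1) && (mdeg j == k.+1)) \sum_(i < n.+1 | (0 < j i)%N)
   (b i.+1 * mmono b (mdec i j)) *+ (mcoef (mdec i j) * 'C(n, i))).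
  rewrite bellBE; apply: eq_bigr => j /andP[/eqP wj _].
  rewrite (mcoef_rec wj) -sumrMnr; apply: eq_bigr => i j_gt0.
  by rewrite (mmono_dec j_gt0).
(* For each [i], remove one unit from the entry [i] of the multi-index. *)
rewrite (exchange_big_dep predT) //=; apply: eq_bigr => i _.
rewrite (@bellB_widen (n - i) n.+1) ?leqW ?leq_subr //.
rewrite big_distrr -sumrMnl /=.
rewrite [RHS](reindex_onto (mdec i) (minc i)) => [|j /andP[/eqP wj _]]; last first.
  apply: mincK; rewrite ltnS; apply: leq_trans (leq_subr i n).
  by rewrite -wj; apply: leq_trans (leq_mweight i j); rewrite leq_pmull.
apply: eq_big => [j|j _].
  rewrite mdecK; case: (posnP (j i)) => [_|j_gt0]; rewrite ?andbF ?andbT //.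
  rewrite (mweight_dec j_gt0) (mdeg_dec j_gt0) eqSS; congr (_ && _).
  by rewrite addSn eqSS -(eqn_add2l i _ (n - i)) subnKC ?leq_ord.
by rewrite mulrnAr -mulrnA.
Qed.

Lemma bellB_small n k b : (n < k)%N -> bellB n k b = 0.
Proof.
move=> lt_nk; rewrite bellBE big1 // => j /andP[/eqP wj /eqP dj].
by have := mdeg_le_mweight j; rewrite wj dj leqNgt lt_nk.
Qed.

Lemma bellB00 b : bellB 0 0 b = 1.
Proof.
rewrite bellBE (bigD1 [ffun=> ord0]) /=; last by rewrite /mweight /mdeg !big_ord0.
rewrite big1 => [|j /andP[_ /eqP[]]]; last by apply/ffunP => -[].
by rewrite addr0 /mmono /mcoef /mweight /mden !big_ord0.
Qed.

Lemma bellBS0 n b : bellB n.+1 0 b = 0.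
Proof.
rewrite bellBE big1 // => j /andP[/eqP wj /eqP dj].
have: mweight j = 0%N.
  rewrite /mweight big1 // => i _.
  by move/eqP: dj; rewrite sum_nat_eq0 => /forallP/(_ i)/eqP->; rewrite muln0.
by rewrite wj.
Qed.

Lemma eq_bellB n k b b' :
  (forall i, (0 < i <= n)%N -> b i = b' i) -> bellB n k b = bellB n k b'.
Proof.
move=> eq_b; apply: eq_bigr => j _; congr (_ *+ _); apply: eq_bigr => i _.
by rewrite eq_b /=.
Qed.

End Bell.

(** * Derivations and the Leibniz rule *)

Section Derivation.
Variable T : comPzRingType.

Lemma coef_hmul (u v : hurwitz T) n :
  (u * v) n = \sum_(k < n.+1) (u k * v (n - k)%N) *+ 'C(n, k).
Proof. by []. Qed.

(** Coefficientwise this is Pascal's rule. *)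
Lemma hderivM (u v : hurwitz T) :
  hderiv (u * v) = hderiv u * v + u * hderiv v.
Proof.
apply: hurwitzP => n.
rewrite -[LHS]/((u * v) n.+1) -[RHS]/((hderiv u * v) n + (u * hderiv v) n).
rewrite !coef_hmul [LHS]big_ord_recl /= bin0 subn0.
rewrite [X in _ = _ + X]big_ord_recl /= bin0 subn0 addrCA; congr (_ + _).
under eq_bigr do rewrite /bump /= add1n binS mulrnDr subSS addrC.
rewrite big_split /=; congr (_ + _).
rewrite big_ord_recr /= bin_small // mulr0n addr0; apply: eq_bigr => i _.
by rewrite /bump /= add1n subnSK.
Qed.

Variable D : T -> T.
Hypothesis DD : forall u v, D (u + v) = D u + D v.
Hypothesis DM : forall u v, D (u * v) = D u * v + u * D v.

Lemma iter_derivD n u v : iter n D (u + v) = iter n D u + iter n D v.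
Proof. by elim: n => //= n ->; rewrite DD. Qed.

(** The Taylor series [flow u = sum_n D^n u t^n / n!] is a Hurwitz series, and
    the claim is that [flow] is multiplicative. As [hderiv (flow u) = flow (D u)]
    and both [hderiv] and [D] are derivations, coefficient [n.+1] for [(u, v)] is
    the sum of coefficients [n] for [(D u, v)] and [(u, D v)]. *)
Lemma leibniz n u v :
  iter n D (u * v) =
  \sum_(i < n.+1) (iter i D u * iter (n - i) D v) *+ 'C(n, i).
Proof.
pose flow h := Hurwitz (fun m => iter m D h).
have flowD h : hderiv (flow h) = flow (D h).
  by apply: hurwitzP => m /=; rewrite -iterSr.
rewrite -[RHS]/((flow u * flow v) n).
elim: n u v => [|n IHn] u v.
  by rewrite /= big_ord_recl big_ord0 addr0.
rewrite iterSr DM iter_derivD !IHn -!flowD.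
by rewrite -[RHS]/(hderiv (flow u * flow v) n) hderivM.
Qed.

End Derivation.

(** * Autonomous polynomials as iterated Lie derivatives *)

Section Autonomous.
Variable R : comPzRingType.
Implicit Types f g h : hurwitz R.

Lemma hderiv0 : hderiv (0 : hurwitz R) = 0.
Proof. exact: hurwitzP. Qed.

Lemma hderivD f g : hderiv (f + g) = hderiv f + hderiv g.
Proof. exact: hurwitzP. Qed.

Lemma hderiv_var : hderiv (hvar : hurwitz R) = 1.
Proof. by apply: hurwitzP => -[|n]. Qed.

Lemma hderiv1 : hderiv (1 : hurwitz R) = 0.
Proof. exact: hurwitzP. Qed.

(** The derivative of [h] along the vector field [f d/dx]. *)
Definition lie f h := f * hderiv h.

Lemma lieD f g h : lie f (g + h) = lie f g + lie f h.
Proof. by rewrite /lie hderivD mulrDr. Qed.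

Lemma lieM f g h : lie f (g * h) = lie f g * h + g * lie f h.
Proof. by rewrite /lie hderivM mulrDr mulrA mulrCA. Qed.

Lemma lie_var f : lie f hvar = f.
Proof. by rewrite /lie hderiv_var mulr1. Qed.

(** The flow [y] of [f] satisfies [d^n/dt^n h(y) = (lie f)^n h] at [t = 0], and
    the derivatives of [y] at [0] are the [(lie f)^i x], so this is the
    Faa di Bruno formula for [h(y)]. In the induction [h] must vary: the step
    uses the formula for [delta h]. *)
Lemma faa_di_bruno f h n :
  iter n (lie f) h =
  \sum_(k < n.+1) bellB n k (fun i => iter i (lie f) hvar)
                  * iter k (@hderiv R) h.
Proof.
set b := fun i => iter i (lie f) hvar.
have [m] := ubnP n; elim: m n h => // m IHm [|n] h lt_nm.
  by rewrite big_ord_recl big_ord0 bellB00 mul1r addr0.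
rewrite big_ord_recl bellBS0 mul0r add0r iterSr.
rewrite [lie f h]/lie (leibniz (lieD f) (lieM f)).
under [RHS]eq_bigr do
  rewrite lift0 bellB_rec iterSr big_distrl /=.
rewrite exchange_big /=; apply: eq_bigr => i _.
rewrite (IHm _ _ (leq_ltn_trans (leq_subr i n) lt_nm)).
(* The terms with [n - i < k] that this adds are zero by [bellB_small]. *)
rewrite (big_ord_widen n.+1
  (fun k => bellB (n - i) k b * iter k (@hderiv R) (hderiv h)));
  last by rewrite ltnS leq_subr.
rewrite big_mkcond big_distrr /= -sumrMnl; apply: eq_bigr => k _.
have ->: lie f (b i) = iter i (lie f) f by rewrite -iterS iterSr lie_var.
rewrite mulrnAl -mulrA; congr (_ * _ *+ _).
by case: ifPn => //; rewrite -leqNgt => /bellB_small ->; rewrite mul0r.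
Qed.

(** By strong induction: [A_(n+1)(f)] is the Faa di Bruno expansion of
    [(lie f)^n f] written with [A_1(f), ..., A_n(f)], and [f = lie f x]. *)
Lemma aut_lie f n : aut f n = iter n (lie f) hvar.
Proof.
have [m] := ubnP n; elim: m n => // m IHm [|[|n]] lt_nm //.
  by rewrite aut1E /= lie_var.
rewrite autSE // iterSr lie_var faa_di_bruno /bellY big_add1 big_mkord.
rewrite [RHS]big_ord_recl bellBS0 mul0r add0r; apply: eq_bigr => k _.
rewrite lift0; congr (_ * _); apply: eq_bellB => i /andP[_ le_in].
by apply: IHm; rewrite -ltnS (leq_ltn_trans _ lt_nm).
Qed.

Lemma autS f n : aut f n.+1 = f * hderiv (aut f n).
Proof. by rewrite !aut_lie. Qed.

Lemma aut_sum f g n : (0 < n)%N ->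
  aut (f + g) n = aut f n + aut g n + boxH (aut f) (aut g) n.
Proof.
have boxHS m : boxH (aut f) (aut g) m.+2 =
    f * hderiv (aut g m.+1) + g * hderiv (aut f m.+1)
    + (f + g) * hderiv (boxH (aut f) (aut g) m.+1) by [].
elim: n => // -[_ _|n IHn _]; first by rewrite /= !aut1E addr0.
rewrite autS IHn // !hderivD boxHS mulrDr [RHS]addrA; congr (_ + _).
by rewrite (autS f n.+1) (autS g n.+1) mulrDl !mulrDr [RHS]addrACA
           [g * _ + _]addrC.
Qed.

Lemma box_add_aut f g : box_add (aut f) (aut g) = aut (f + g).
Proof.
by apply: funext => -[|[|n]] //; rewrite [RHS]aut_sum.
Qed.

Lemma box_mul_aut f g : box_mul (aut f) (aut g) = aut (f * g).
Proof. by rewrite /box_mul !aut1E. Qed.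

Lemma rho_aut0 : rho (aut 0) = hconst (hvar : hurwitz R).
Proof. by apply: hurwitzP => -[|n] //=; rewrite autS mul0r. Qed.

Lemma rho_aut1 : rho (aut 1) = hconst (hvar : hurwitz R) + hvar.
Proof.
apply: hurwitzP => -[|[|n]] /=; first by rewrite addr0.
  by rewrite aut1E add0r.
rewrite addr0; elim: n => [|n IHn]; first by rewrite autS aut1E hderiv1 mulr0.
by rewrite autS IHn hderiv0 mulr0.
Qed.

End Autonomous.

(** * Transport of the ring structure *)

Section Transport.
Variable R : comPzRingType.

(** A name of its own for the carrier keeps the structures below off the generic
    subtype of a set. *)
Definition autT : Type := rho_aut_set R.

HB.instance Definition _ := gen_eqMixin autT.
HB.instance Definition _ := gen_choiceMixin autT.

Definition to_autT (f : hurwitz R) : autT :=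
  exist _ (rho (aut f)) (mem_set (imageT (fun f => rho (aut f)) f)).
Definition of_autT (F : autT) : hurwitz R := sval F 1%N.

Lemma to_autTK : cancel to_autT of_autT.
Proof. by []. Qed.

Lemma of_autTK : cancel of_autT to_autT.
Proof.
case=> F F_in; apply: eq_exist; rewrite /of_autT /=.
by case: (set_mem F_in) => f _ <-.
Qed.

Lemma of_autTE (f : hurwitz R) F : sval F = rho (aut f) -> of_autT F = f.
Proof. by rewrite /of_autT => ->. Qed.

Definition autT0 := to_autT 0.
Definition autT1 := to_autT 1.
Definition autT_opp F := to_autT (- of_autT F).
Definition autT_add F G := to_autT (of_autT F + of_autT G).
Definition autT_mul F G := to_autT (of_autT F * of_autT G).

Fact autT_addA : associative autT_add.
Proof. by move=> F G H; rewrite /autT_add !to_autTK addrA. Qed.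
Fact autT_addC : commutative autT_add.
Proof. by move=> F G; rewrite /autT_add addrC. Qed.
Fact autT_add0 : left_id autT0 autT_add.
Proof. by move=> F; rewrite /autT_add to_autTK add0r of_autTK. Qed.
Fact autT_addN : left_inverse autT0 autT_opp autT_add.
Proof. by move=> F; rewrite /autT_add to_autTK addNr. Qed.

HB.instance Definition _ :=
  GRing.isZmodule.Build autT autT_addA autT_addC autT_add0 autT_addN.

Fact autT_mulA : associative autT_mul.
Proof. by move=> F G H; rewrite /autT_mul !to_autTK mulrA. Qed.
Fact autT_mulC : commutative autT_mul.
Proof. by move=> F G; rewrite /autT_mul mulrC. Qed.
Fact autT_mul1 : left_id autT1 autT_mul.
Proof. by move=> F; rewrite /autT_mul to_autTK mul1r of_autTK. Qed.
Fact autT_mulDl : left_distributive autT_mul autT_add.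
Proof. by move=> F G H; rewrite /autT_mul /autT_add !to_autTK mulrDl. Qed.

HB.instance Definition _ :=
  GRing.Zmodule_isComPzRing.Build autT autT_mulA autT_mulC autT_mul1 autT_mulDl.

End Transport.

Theorem theorem15 (R : idomainType) (charR0 : [pchar R] =i pred0) :
  exists c : GRing.ComPzRing.axioms_ (rho_aut_set R),
    let K : comPzRingType := GRing.ComPzRing.Pack c in
    [/\ forall (f g : hurwitz R) (F G : K),
          sval F = rho (aut f) -> sval G = rho (aut g) ->
          sval (F + G) = rho (box_add (aut f) (aut g)),
        forall (f g : hurwitz R) (F G : K),
          sval F = rho (aut f) -> sval G = rho (aut g) ->
          sval (F * G) = rho (box_mul (aut f) (aut g)),
        sval (0 : K) = rho (aut 0) /\ rho (aut 0) = hconst (hvar : hurwitz R)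
      & sval (1 : K) = rho (aut 1) /\ rho (aut 1) = hconst (hvar : hurwitz R) + hvar].
Proof.
exists (GRing.ComPzRing.class (autT R)) => K; split.
- move=> f g F G /of_autTE Ff /of_autTE Gg.
  by rewrite box_add_aut -Ff -Gg.
- move=> f g F G /of_autTE Ff /of_autTE Gg.
  by rewrite box_mul_aut -Ff -Gg.
- by split; last exact: rho_aut0.
- by split; last exact: rho_aut1.
Qed.
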